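(* Let $(\mathcal{C},\mathbb{E},\mathfrak{s})$ be a skeletally small extriangulated category. Then the category of defects $\mathsf{def}\,\mathbb{E}$ is a Serre subcategory of the abelian category $\mathsf{coh}\,\mathcal{C}$ of coherent right $\mathcal{C}$-modules.
   Context: Conventions: all categories and functors are additive; all subcategories are additive, full and closed under isomorphisms. $\mathcal{A}b$ is the category of abelian groups. Extriangulated categories (Nakaoka--Palu). Let $\mathcal{C}$ be an additive category and $\mathbb{E}\colon\mathcal{C}^{\mathrm{op}}\times\mathcal{C}\to\mathcal{A}b$ an additive bifunctor. For $\delta\in\mathbb{E}(C,A)$, $a\colon A\to A'$, $c\colon C'\to C$ write $a_*\delta=\mathbb{E}(\mathrm{id}_C,a)(\delta)$ and $c^*\delta=\mathbb{E}(c,\mathrm{id}_A)(\delta)$. For $\delta_i\in\mathbb{E}(C_i,A_i)$ ($i=1,2$), a morphism $(a,c)\colon\delta_1\to\delta_2$ is a pair $a\colon A_1\to A_2$, $c\colon C_1\to C_2$ with $a_*\delta_1=c^*\delta_2$. The element $\delta_1\oplus\delta_2\in\mathbb{E}(C_1\oplus C_2,A_1\oplus A_2)$ is the one with components $(\delta_1,0,0,\delta_2)$. Two complexes $A\xrightarrow{x}B\xrightarrow{y}C$ and $A\xrightarrow{x'}B'\xrightarrow{y'}C$ are equivalent if there is an isomorphism $b\colon B\to B'$ with $bx=x'$, $y'b=y$. Let $\mathfrak{s}$ assign to each $\delta\in\mathbb{E}(C,A)$ an equivalence class $\mathfrak{s}(\delta)=[A\to B\to C]$; every complex in this class is said to realize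 $\delta$. $\mathfrak{s}$ is a realization if for every morphism $(a,c)\colon\delta_1\to\delta_2$ and all complexes $A_i\xrightarrow{x_i}B_i\xrightarrow{y_i}C_i$ realizing $\delta_i$ there is $b\colon B_1\to B_2$ with $bx_1=x_2a$, $y_2b=cy_1$. It is additive if $\mathfrak{s}(0)=[A\to A\oplus C\to C]$ (canonical inclusion and projection) for $0\in\mathbb{E}(C,A)$, and $\mathfrak{s}(\delta_1\oplus\delta_2)=\mathfrak{s}(\delta_1)\oplus\mathfrak{s}(\delta_2)$. The triple $(\mathcal{C},\mathbb{E},\mathfrak{s})$ is an extriangulated category if $\mathfrak{s}$ is an additive realization and: (ET3) if $A_i\xrightarrow{x_i}B_i\xrightarrow{y_i}C_i$ realize $\delta_i$ ($i=1,2$) and $a\colon A_1\to A_2$, $b\colon B_1\to B_2$ satisfy $bx_1=x_2a$, then there is $c\colon C_1\to C_2$ with $cy_1=y_2b$ and $a_*\delta_1=c^*\delta_2$; (ET3)$^{\mathrm{op}}$ if instead $b$, $c$ are given with $cy_1=y_2b$, then there is $a$ with $bx_1=x_2a$ and $a_*\delta_1=c^*\delta_2$; (ET4) if $A\xrightarrow{f}B\xrightarrow{f'}D$ realizes $\delta\in\mathbb{E}(D,A)$ and $B\xrightarrow{g}C\xrightarrow{g'}F$ realizes $\delta'\in\mathbb{E}(F,B)$, then there are an object $G$, morphisms $h=gf\colon A\to C$, $h'\colon C\to G$, $d\colon D\to G$, $e\colon G\to F$ with $h'g=df'$, $eh'=g'$, and $\delta''\in\mathbb{E}(G,A)$ realized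 by $A\xrightarrow{h}C\xrightarrow{h'}G$, such that $D\xrightarrow{d}G\xrightarrow{e}F$ realizes $f'_*\delta'$, $d^*\delta''=\delta$, and $f_*\delta''=e^*\delta'$; (ET4)$^{\mathrm{op}}$ if $D\xrightarrow{f'}A\xrightarrow{f}B$ realizes $\delta\in\mathbb{E}(B,D)$ and $F\xrightarrow{g'}B\xrightarrow{g}C$ realizes $\delta'\in\mathbb{E}(C,F)$, then there are an object $G$, morphisms $d\colon D\to G$, $e\colon G\to F$, $h'\colon G\to A$, $h=gf\colon A\to C$ with $h'd=f'$, $fh'=g'e$, and $\delta''\in\mathbb{E}(C,G)$ realized by $G\xrightarrow{h'}A\xrightarrow{h}C$, such that $D\xrightarrow{d}G\xrightarrow{e}F$ realizes $g'^*\delta$, $e_*\delta''=\delta'$, and $d_*\delta=g^*\delta''$. A complex $A\xrightarrow{x}B\xrightarrow{y}C$ realizing some $\delta\in\mathbb{E}(C,A)$ is an $\mathfrak{s}$-conflation, and then $y$ is an $\mathfrak{s}$-deflation. Modules. For a skeletally small additive category $\mathcal{C}$, $\mathsf{Mod}\,\mathcal{C}$ is the abelian category of right $\mathcal{C}$-modules, i.e. additive functors $\mathcal{C}^{\mathrm{op}}\to\mathcal{A}b$. $M$ is finitely generated if there is a surjection $\mathcal{C}(-,C)\to M$ with $C\in\mathcal{C}$; finitely presented if there is an exact sequence $\mathcal{C}(-,B)\to\mathcal{C}(-,C)\to M\to0$ with $B,C\in\mathcal{C}$; coherent if it is finitely presented and every finitely generated submodule is finitely presented. $\mathsf{coh}\,\mathcal{C}\subset\mathsf{Mod}\,\mathcal{C}$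 is the subcategory of coherent modules; it is closed under kernels, cokernels and extensions in $\mathsf{Mod}\,\mathcal{C}$, hence abelian. Defects. For $\delta\in\mathbb{E}(C,A)$ realized by $A\to B\xrightarrow{y}C$, its defect is $\widetilde{\delta}=\operatorname{Coker}(\mathcal{C}(-,y)\colon\mathcal{C}(-,B)\to\mathcal{C}(-,C))$ in $\mathsf{Mod}\,\mathcal{C}$. $\mathsf{def}\,\mathbb{E}$ is the subcategory of $\mathsf{Mod}\,\mathcal{C}$ of modules isomorphic to $\widetilde{\delta}$ for some $A,C\in\mathcal{C}$ and $\delta\in\mathbb{E}(C,A)$. A Serre subcategory of an abelian category is a subcategory closed under subobjects, quotients and extensions. *)

(* Defs.v *)
From HB Require Import structures.
From mathcomp Require Import all_boot all_algebra.
From mathcomp Require Import boolp.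

Set Implicit Arguments.
Unset Strict Implicit.
Unset Printing Implicit Defensive.

Import GRing.Theory.
Local Open Scope ring_scope.

(* Homs live in an arbitrary universe: the objects of the base category C may
   form a large type (C is only skeletally small), and a morphism of C-modules
   is a family indexed by these objects. *)
Record category := Category {
  ob :> Type;
  hom : ob -> ob -> Type;
  cid : forall X, hom X X;
  ccomp : forall X Y Z, hom Y Z -> hom X Y -> hom X Z;
  czero : forall X Y, hom X Y;
  ccomp1f : forall X Y (f : hom X Y), ccomp (cid Y) f = f;
  ccompf1 : forall X Y (f : hom X Y), ccomp f (cid X) = f;
  ccompA : forall X Y Z T (h : hom Z T) (g : hom Y Z) (f : hom X Y),
    ccomp h (ccomp g f) = ccomp (ccomp h g) f;
  ccomp0f : forall X Y Z (f : hom X Y), ccomp (czero Y Z) f = czero X Z;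
  ccompf0 : forall X Y Z (g : hom Y Z), ccomp g (czero X Y) = czero X Z
}.
Arguments hom {c} _ _.
Arguments cid {c} _.
Arguments ccomp {c X Y Z} _ _.
Arguments czero {c} _ _.

Declare Scope cat_scope.
Delimit Scope cat_scope with cat.
Local Open Scope cat_scope.
Notation "g ∘ f" := (ccomp g f) (at level 40, left associativity) : cat_scope.

Section CategoryNotions.
Variable A : category.
Implicit Types X Y Z W : A.

Definition isomorphic X Y : Prop :=
  exists (f : hom X Y) (g : hom Y X), g ∘ f = cid X /\ f ∘ g = cid Y.

Definition is_mono X Y (f : hom X Y) : Prop :=
  forall W (u v : hom W X), f ∘ u = f ∘ v -> u = v.

Definition is_epi X Y (f : hom X Y) : Prop :=
  forall W (u v : hom Y W), u ∘ f = v ∘ f -> u = v.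

Definition is_zero_object Z : Prop :=
  (forall X (f : hom X Z), f = czero X Z) /\
  (forall X (f : hom Z X), f = czero Z X).

Definition is_kernel X Y Z (k : hom X Y) (g : hom Y Z) : Prop :=
  g ∘ k = czero X Z /\
  forall W (u : hom W Y), g ∘ u = czero W Z ->
    exists! v : hom W X, k ∘ v = u.

Definition is_cokernel X Y Z (f : hom X Y) (q : hom Y Z) : Prop :=
  q ∘ f = czero X Z /\
  forall W (u : hom Y W), u ∘ f = czero X W ->
    exists! v : hom Z W, v ∘ q = u.

Definition short_exact X Y Z (f : hom X Y) (g : hom Y Z) : Prop :=
  is_kernel f g /\ is_cokernel f g.

Definition is_biproduct X Y Z (i1 : hom X Z) (i2 : hom Y Z)
    (p1 : hom Z X) (p2 : hom Z Y) : Prop :=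
  [/\ p1 ∘ i1 = cid X, p2 ∘ i2 = cid Y,
      p1 ∘ i2 = czero Y X & p2 ∘ i1 = czero X Y] /\
  (forall W (u : hom W X) (v : hom W Y),
     exists! w : hom W Z, p1 ∘ w = u /\ p2 ∘ w = v) /\
  (forall W (u : hom X W) (v : hom Y W),
     exists! w : hom Z W, w ∘ i1 = u /\ w ∘ i2 = v).

(* A full subcategory is given by the predicate S on objects. *)
Record additive_subcategory (S : A -> Prop) : Prop := AdditiveSubcategory {
  subcat_iso : forall X Y, isomorphic X Y -> S X -> S Y;
  subcat_zero : exists Z, is_zero_object Z /\ S Z;
  subcat_biproduct : forall X Y, S X -> S Y ->
    exists Z (i1 : hom X Z) (i2 : hom Y Z) (p1 : hom Z X) (p2 : hom Z Y),
      is_biproduct i1 i2 p1 p2 /\ S Z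
}.

Record serre_subcategory (S : A -> Prop) : Prop := SerreSubcategory {
  serre_additive : additive_subcategory S;
  serre_sub : forall X Y (f : hom X Y), is_mono f -> S Y -> S X;
  serre_quotient : forall X Y (f : hom X Y), is_epi f -> S X -> S Y;
  serre_extension : forall X Y Z (f : hom X Y) (g : hom Y Z),
    short_exact f g -> S X -> S Z -> S Y
}.

End CategoryNotions.

Section FullSubcategory.
Variables (A : category) (P : A -> Prop).

Definition full_subcategory : category.
Proof.
by refine (@Category {X : A | P X} (fun X Y => hom (sval X) (sval Y))
  (fun X => cid (sval X)) (fun X Y Z g f => g ∘ f)
  (fun X Y => czero (sval X) (sval Y)) _ _ _ _ _);
  move=> *; rewrite ?ccomp1f ?ccompf1 ?ccompA ?ccomp0f ?ccompf0.
Defined.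

End FullSubcategory.

(* [zeroob], [dsum] are a choice of zero object and of binary biproducts. *)
Record additiveCategory := AdditiveCategory {
  aob :> Type;
  mor : aob -> aob -> zmodType;
  idm : forall X, mor X X;
  comp : forall X Y Z, mor Y Z -> mor X Y -> mor X Z;
  comp1f : forall X Y (f : mor X Y), comp (idm Y) f = f;
  compf1 : forall X Y (f : mor X Y), comp f (idm X) = f;
  compA : forall X Y Z T (h : mor Z T) (g : mor Y Z) (f : mor X Y),
    comp h (comp g f) = comp (comp h g) f;
  compDl : forall X Y Z (g g' : mor Y Z) (f : mor X Y),
    comp (g + g') f = comp g f + comp g' f;
  compDr : forall X Y Z (g : mor Y Z) (f f' : mor X Y),
    comp g (f + f') = comp g f + comp g f';
  zeroob : aob;
  to_zeroob : forall X (f : mor X zeroob), f = 0;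
  from_zeroob : forall X (f : mor zeroob X), f = 0;
  dsum : aob -> aob -> aob;
  inj1 : forall X Y, mor X (dsum X Y);
  inj2 : forall X Y, mor Y (dsum X Y);
  prj1 : forall X Y, mor (dsum X Y) X;
  prj2 : forall X Y, mor (dsum X Y) Y;
  prj1_inj1 : forall X Y, comp (prj1 X Y) (inj1 X Y) = idm X;
  prj2_inj2 : forall X Y, comp (prj2 X Y) (inj2 X Y) = idm Y;
  prj1_inj2 : forall X Y, comp (prj1 X Y) (inj2 X Y) = 0;
  prj2_inj1 : forall X Y, comp (prj2 X Y) (inj1 X Y) = 0;
  inj_prj : forall X Y,
    comp (inj1 X Y) (prj1 X Y) + comp (inj2 X Y) (prj2 X Y) = idm (dsum X Y)
}.
Arguments mor {a} _ _.
Arguments idm {a} _.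
Arguments comp {a X Y Z} _ _.
Arguments zeroob {a}.
Arguments inj1 {a} X Y.
Arguments inj2 {a} X Y.
Arguments prj1 {a} X Y.
Arguments prj2 {a} X Y.

Notation "g ⋅ f" := (comp g f) (at level 40, left associativity) : cat_scope.
Notation "X ⊕ Y" := (dsum X Y) (at level 50, left associativity) : cat_scope.

Section AdditiveTheory.
Variable C : additiveCategory.
Implicit Types X Y Z : C.

Lemma compBl X Y Z (g g' : mor Y Z) (f : mor X Y) :
  (g - g') ⋅ f = g ⋅ f - g' ⋅ f.
Proof. by apply: (addIr (g' ⋅ f)); rewrite -compDl !subrK. Qed.

Lemma compBr X Y Z (g : mor Y Z) (f f' : mor X Y) :
  g ⋅ (f - f') = g ⋅ f - g ⋅ f'.
Proof. by apply: (addIr (g ⋅ f')); rewrite -compDr !subrK. Qed.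

Lemma comp0f X Y Z (f : mor X Y) : (0 : mor Y Z) ⋅ f = 0.
Proof. by rewrite -[0 in LHS](subrr 0) compBl subrr. Qed.

Lemma compf0 X Y Z (g : mor Y Z) : g ⋅ (0 : mor X Y) = 0.
Proof. by rewrite -[0 in LHS](subrr 0) compBr subrr. Qed.

Definition dsum_map X X' Y Y' (f : mor X X') (g : mor Y Y') :
    mor (X ⊕ Y) (X' ⊕ Y') :=
  inj1 X' Y' ⋅ f ⋅ prj1 X Y + inj2 X' Y' ⋅ g ⋅ prj2 X Y.

Definition is_iso X Y (f : mor X Y) : Prop :=
  exists g : mor Y X, g ⋅ f = idm X /\ f ⋅ g = idm Y.

(* The index type lives in the universe of the carriers of zmodTypes, i.e. the
   universe of the hom-sets of C, whereas the type of objects need not. *)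
Definition skeletally_small : Prop :=
  exists (I : Type@{Algebra.Zmodule.axioms_.u0}) (F : I -> C),
    forall X, exists i (f : mor X (F i)), is_iso f.

End AdditiveTheory.

(* [bf C A] is E(C, A): contravariant in its first argument. *)
Record additiveBifunctor (C : additiveCategory) := AdditiveBifunctor {
  bf :> C -> C -> zmodType;
  bfmap : forall X X' Y Y' : C, mor X' X -> mor Y Y' ->
    {additive bf X Y -> bf X' Y'};
  bfmap1 : forall X Y (d : bf X Y), bfmap (idm X) (idm Y) d = d;
  bfmap_comp : forall X X' X'' Y Y' Y'' (c : mor X' X) (c' : mor X'' X')
      (a : mor Y Y') (a' : mor Y' Y'') (d : bf X Y),
    bfmap (c ⋅ c') (a' ⋅ a) d = bfmap c' a' (bfmap c a d);
  bfmapDl : forall X X' Y Y' (c c' : mor X' X) (a : mor Y Y') (d : bf X Y),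
    bfmap (c + c') a d = bfmap c a d + bfmap c' a d;
  bfmapDr : forall X X' Y Y' (c : mor X' X) (a a' : mor Y Y') (d : bf X Y),
    bfmap c (a + a') d = bfmap c a d + bfmap c a' d
}.

Section Bifunctor.
Variables (C : additiveCategory) (E : additiveBifunctor C).
Implicit Types X Y : C.

Definition push X Y Y' (a : mor Y Y') (d : E X Y) : E X Y' :=
  bfmap E (idm X) a d.

Definition pull X X' Y (c : mor X' X) (d : E X Y) : E X' Y :=
  bfmap E c (idm Y) d.

Definition ext_morphism X1 X2 Y1 Y2 (d1 : E X1 Y1) (d2 : E X2 Y2)
    (a : mor Y1 Y2) (c : mor X1 X2) : Prop :=
  push a d1 = pull c d2.

(* d is the element with components (d1, 0, 0, d2) under
   E(X1 ⊕ X2, Y1 ⊕ Y2) = E(X1,Y1) ⊕ E(X1,Y2) ⊕ E(X2,Y1) ⊕ E(X2,Y2). *)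
Definition is_ext_dsum X1 X2 Y1 Y2 (d1 : E X1 Y1) (d2 : E X2 Y2)
    (d : E (X1 ⊕ X2) (Y1 ⊕ Y2)) : Prop :=
  [/\ bfmap E (inj1 X1 X2) (prj1 Y1 Y2) d = d1,
      bfmap E (inj1 X1 X2) (prj2 Y1 Y2) d = 0,
      bfmap E (inj2 X1 X2) (prj1 Y1 Y2) d = 0 &
      bfmap E (inj2 X1 X2) (prj2 Y1 Y2) d = d2].

Definition equivalent_complexes X Y B B' (x : mor Y B) (y : mor B X)
    (x' : mor Y B') (y' : mor B' X) : Prop :=
  exists b : mor B B', [/\ is_iso b, b ⋅ x = x' & y' ⋅ b = y].

End Bifunctor.

(* An assignment of an equivalence class of complexes Y -> B -> X to each
   d : E X Y; [realizes d x y] says that Y -x-> B -y-> X belongs to the class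
   of d, and the three axioms say that these complexes form exactly one
   equivalence class. *)
Record realizationData (C : additiveCategory) (E : additiveBifunctor C) :=
  RealizationData {
  realizes : forall X Y B : C, E X Y -> mor Y B -> mor B X -> Prop;
  realizes_complex : forall X Y B (d : E X Y) (x : mor Y B) (y : mor B X),
    realizes d x y -> y ⋅ x = 0;
  realizes_ex : forall X Y (d : E X Y),
    exists (B : C) (x : mor Y B) (y : mor B X), realizes d x y;
  realizes_class : forall X Y B B' (d : E X Y) (x : mor Y B) (y : mor B X)
      (x' : mor Y B') (y' : mor B' X),
    realizes d x y ->
    (realizes d x' y' <-> equivalent_complexes x y x' y')
}.

Section Extriangulated.
Variables (C : additiveCategory) (E : additiveBifunctor C).
Variable s : realizationData E.

Definition is_realization : Prop :=
  forall (A1 B1 C1 A2 B2 C2 : C) (d1 : E C1 A1) (d2 : E C2 A2)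
    (x1 : mor A1 B1) (y1 : mor B1 C1) (x2 : mor A2 B2) (y2 : mor B2 C2)
    (a : mor A1 A2) (c : mor C1 C2),
  ext_morphism d1 d2 a c -> realizes s d1 x1 y1 -> realizes s d2 x2 y2 ->
  exists b : mor B1 B2, b ⋅ x1 = x2 ⋅ a /\ y2 ⋅ b = c ⋅ y1.

Definition is_additive_realization : Prop :=
  [/\ is_realization,
      forall A X : C, realizes s (0 : E X A) (inj1 A X) (prj2 A X) &
      forall (A1 B1 C1 A2 B2 C2 : C) (d1 : E C1 A1) (d2 : E C2 A2)
        (d : E (C1 ⊕ C2) (A1 ⊕ A2))
        (x1 : mor A1 B1) (y1 : mor B1 C1) (x2 : mor A2 B2) (y2 : mor B2 C2),
      is_ext_dsum d1 d2 d -> realizes s d1 x1 y1 -> realizes s d2 x2 y2 ->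
      realizes s d (dsum_map x1 x2) (dsum_map y1 y2)].

Definition ET3 : Prop :=
  forall (A1 B1 C1 A2 B2 C2 : C) (d1 : E C1 A1) (d2 : E C2 A2)
    (x1 : mor A1 B1) (y1 : mor B1 C1) (x2 : mor A2 B2) (y2 : mor B2 C2)
    (a : mor A1 A2) (b : mor B1 B2),
  realizes s d1 x1 y1 -> realizes s d2 x2 y2 -> b ⋅ x1 = x2 ⋅ a ->
  exists c : mor C1 C2, c ⋅ y1 = y2 ⋅ b /\ push a d1 = pull c d2.

Definition ET3op : Prop :=
  forall (A1 B1 C1 A2 B2 C2 : C) (d1 : E C1 A1) (d2 : E C2 A2)
    (x1 : mor A1 B1) (y1 : mor B1 C1) (x2 : mor A2 B2) (y2 : mor B2 C2)
    (b : mor B1 B2) (c : mor C1 C2),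
  realizes s d1 x1 y1 -> realizes s d2 x2 y2 -> c ⋅ y1 = y2 ⋅ b ->
  exists a : mor A1 A2, b ⋅ x1 = x2 ⋅ a /\ push a d1 = pull c d2.

Definition ET4 : Prop :=
  forall (A B D X F : C) (d : E D A) (d' : E F B)
    (f : mor A B) (f' : mor B D) (g : mor B X) (g' : mor X F),
  realizes s d f f' -> realizes s d' g g' ->
  exists (G : C) (h' : mor X G) (u : mor D G) (e : mor G F) (d'' : E G A),
    [/\ h' ⋅ g = u ⋅ f', e ⋅ h' = g' & realizes s d'' (g ⋅ f) h'] /\
    [/\ realizes s (push f' d') u e, pull u d'' = d & push f d'' = pull e d'].

Definition ET4op : Prop :=
  forall (A B D X F : C) (d : E B D) (d' : E X F)
    (f' : mor D A) (f : mor A B) (g' : mor F B) (g : mor B X),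
  realizes s d f' f -> realizes s d' g' g ->
  exists (G : C) (u : mor D G) (e : mor G F) (h' : mor G A) (d'' : E X G),
    [/\ h' ⋅ u = f', f ⋅ h' = g' ⋅ e & realizes s d'' h' (g ⋅ f)] /\
    [/\ realizes s (pull g' d) u e, push e d'' = d' & push u d = pull g d''].

Definition is_extriangulated : Prop :=
  [/\ is_additive_realization, ET3, ET3op, ET4 & ET4op].

End Extriangulated.

Record rmodule (C : additiveCategory) := RModule {
  mval :> C -> zmodType;
  mact : forall X Y : C, mor X Y -> {additive mval Y -> mval X};
  mact1 : forall X (m : mval X), mact (idm X) m = m;
  mact_comp : forall X Y Z (g : mor Y Z) (f : mor X Y) (m : mval Z),
    mact (g ⋅ f) m = mact f (mact g m);
  mactD : forall X Y (f f' : mor X Y) (m : mval Y),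
    mact (f + f') m = mact f m + mact f' m
}.

Record modhom (C : additiveCategory) (M N : rmodule C) := ModHom {
  mhfun :> forall X, M X -> N X;
  mhfunB : forall X, zmod_morphism (@mhfun X);
  mhnat : forall X Y (f : mor X Y) (m : M Y),
    mhfun (mact M f m) = mact N f (mhfun m)
}.
Arguments mhfun {C M N} _ {X} _.

Section ModuleCategory.
Variable C : additiveCategory.
Implicit Types M N P : rmodule C.

Lemma modhomP M N (u v : modhom M N) :
  (forall X (m : M X), u X m = v X m) -> u = v.
Proof.
case: u v => [u uB un] [v vB vn] /= uv.
have {}uv : u = v.
  by apply: functional_extensionality_dep => X; apply: funext => m; apply: uv.
by subst v; congr ModHom; apply: Prop_irrelevance.
Qed.

Definition modhom_id M : modhom M M.
Proof. by exists (fun X m => m). Defined.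

Definition modhom_comp M N P (v : modhom N P) (u : modhom M N) : modhom M P.
Proof.
exists (fun X m => v X (u X m)); first by move=> X m n; rewrite !mhfunB.
by move=> X Y f m; rewrite !mhnat.
Defined.

Definition modhom_zero M N : modhom M N.
Proof.
exists (fun X _ => 0); first by move=> X m n; rewrite subr0.
by move=> X Y f m; rewrite raddf0.
Defined.

Lemma modhom0 M N (u : modhom M N) X : u X 0 = 0.
Proof. by rewrite -(subrr 0) mhfunB subrr. Qed.

Definition Mod : category.
Proof.
refine (@Category (rmodule C) (@modhom C) modhom_id modhom_comp modhom_zero
  _ _ _ _ _); try by move=> *; apply: modhomP.
by move=> M N P g; apply: modhomP => X m; apply: modhom0.
Defined.

Section Representable.
Variable B : C.

Section Action.
Variables (X Y : C) (f : mor X Y).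
Definition precomp (g : mor Y B) : mor X B := g ⋅ f.
Lemma precomp_zmod_morphism : zmod_morphism precomp.
Proof. by move=> g g'; apply: compBl. Qed.
HB.instance Definition _ :=
  GRing.isZmodMorphism.Build (mor Y B) (mor X B) precomp precomp_zmod_morphism.
End Action.

Definition yoneda : rmodule C.
Proof.
refine (@RModule C (fun X => mor X B) (fun X Y f => precomp f) _ _ _).
- by move=> X m; apply: compf1.
- by move=> X Y Z g f m; apply: compA.
- by move=> X Y f f' m; apply: compDr.
Defined.

End Representable.

Definition yoneda_map (B D : C) (y : mor B D) : modhom (yoneda B) (yoneda D).
Proof.
exists (fun X (g : mor X B) => y ⋅ g); first by move=> X g g'; apply: compBr.
by move=> X Y f g; apply: compA.
Defined.

Definition mod_injective M N (u : modhom M N) : Prop :=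
  forall X, injective (u X).

Definition mod_surjective M N (u : modhom M N) : Prop :=
  forall X (n : N X), exists m : M X, u X m = n.

Definition mod_exact M N P (u : modhom M N) (v : modhom N P) : Prop :=
  forall X (n : N X), v X n = 0 <-> exists m : M X, u X m = n.

Definition finitely_generated M : Prop :=
  exists (B : C) (p : modhom (yoneda B) M), mod_surjective p.

Definition finitely_presented M : Prop :=
  exists (B D : C) (u : modhom (yoneda B) (yoneda D)) (p : modhom (yoneda D) M),
    mod_exact u p /\ mod_surjective p.

(* A submodule of M is given by an injective morphism into M. *)
Definition coherent M : Prop :=
  finitely_presented M /\
  forall N (i : modhom N M),
    mod_injective i -> finitely_generated N -> finitely_presented N.

Definition coh : category := full_subcategory (A := Mod) coherent.

End ModuleCategory.

Section Defects.
Variables (C : additiveCategory) (E : additiveBifunctor C).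
Variable s : realizationData E.

Definition is_defect (X A : C) (d : E X A) (M : Mod C) : Prop :=
  exists (B : C) (x : mor A B) (y : mor B X) (q : hom (yoneda X : Mod C) M),
    realizes s d x y /\
    is_cokernel (yoneda_map y : hom (yoneda B : Mod C) (yoneda X)) q.

Definition in_def (M : Mod C) : Prop :=
  exists (A X : C) (d : E X A) (D : Mod C), is_defect d D /\ isomorphic M D.

End Defects.

(* Main.v *)
(* If d in E(X,A) is realized by A -> B -y-> X, then g : W -> X factors through y
   iff g^*d = 0, so the defect of d is the submodule of E(-,A) generated by d.
   A finitely generated submodule of a defect is thus generated by some g^*d, and
   is the defect of g^*d; hence defects are coherent and closed under subobjects.
   A coherent quotient of the defect of y has a presentation by a map [k, y], and
   an extension of defects of y1, y2 one by a matrix [[y1, -c], [0, y2]]; both are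
   composites of direct sums of deflations, isomorphisms and split projections,
   hence deflations by (ET4)^op.  Monomorphisms and epimorphisms of coh C are
   tested on cyclic submodules and on cokernels, which are again coherent. *)
From HB Require Import structures.
From mathcomp Require Import all_boot all_algebra.
From mathcomp Require Import boolp.
Require Import Defs.

Set Implicit Arguments.
Unset Strict Implicit.
Unset Printing Implicit Defensive.

Import GRing.Theory.
Local Open Scope ring_scope.
Local Open Scope quotient_scope.
Local Open Scope cat_scope.

(** * Column vectors and elementary matrices on biproducts *)

Section Pairing.
Variable C : additiveCategory.

Definition pair_mor (W X Y : C) (u : mor W X) (v : mor W Y) : mor W (X ⊕ Y) :=
  inj1 X Y ⋅ u + inj2 X Y ⋅ v.

Lemma prj1_pair (W X Y : C) (u : mor W X) (v : mor W Y) :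
  prj1 X Y ⋅ pair_mor u v = u.
Proof.
by rewrite compDr !compA prj1_inj1 prj1_inj2 comp1f comp0f addr0.
Qed.

Lemma prj2_pair (W X Y : C) (u : mor W X) (v : mor W Y) :
  prj2 X Y ⋅ pair_mor u v = v.
Proof.
by rewrite compDr !compA prj2_inj1 prj2_inj2 comp1f comp0f add0r.
Qed.

Lemma pair_prj (W X Y : C) (g : mor W (X ⊕ Y)) :
  pair_mor (prj1 X Y ⋅ g) (prj2 X Y ⋅ g) = g.
Proof. by rewrite /pair_mor !compA -compDl inj_prj comp1f. Qed.

Lemma dsum_map_pair (W X X' Y Y' : C) (f : mor X X') (g : mor Y Y')
    (u : mor W X) (v : mor W Y) :
  dsum_map f g ⋅ pair_mor u v = pair_mor (f ⋅ u) (g ⋅ v).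
Proof. by rewrite /dsum_map compDl -!compA prj1_pair prj2_pair. Qed.

(** The elementary matrix $[[1,c],[0,1]]$ on $X \oplus Y$; [shear2] is $[[1,0],[c,1]]$. *)
Definition shear1 (X Y : C) (c : mor Y X) : mor (X ⊕ Y) (X ⊕ Y) :=
  idm _ + inj1 X Y ⋅ c ⋅ prj2 X Y.

Definition shear2 (X Y : C) (c : mor X Y) : mor (X ⊕ Y) (X ⊕ Y) :=
  idm _ + inj2 X Y ⋅ c ⋅ prj1 X Y.

Lemma shear1_pair (W X Y : C) (c : mor Y X) (u : mor W X) (v : mor W Y) :
  shear1 c ⋅ pair_mor u v = pair_mor (u + c ⋅ v) v.
Proof.
by rewrite compDl comp1f -!compA prj2_pair /pair_mor compDr addrAC.
Qed.

Lemma shear2_pair (W X Y : C) (c : mor X Y) (u : mor W X) (v : mor W Y) :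
  shear2 c ⋅ pair_mor u v = pair_mor u (v + c ⋅ u).
Proof.
by rewrite compDl comp1f -!compA prj1_pair /pair_mor compDr addrA.
Qed.

Lemma shear1_iso (X Y : C) (c : mor Y X) : is_iso (shear1 c).
Proof.
exists (shear1 (- c)); split.
  rewrite -[shear1 c]compf1 -[idm _]pair_prj !shear1_pair.
  by rewrite -addrA -compDl subrr comp0f addr0.
rewrite -[shear1 (- c)]compf1 -[idm _]pair_prj !shear1_pair.
by rewrite -addrA -compDl addNr comp0f addr0.
Qed.

Lemma shear2_iso (X Y : C) (c : mor X Y) : is_iso (shear2 c).
Proof.
exists (shear2 (- c)); split.
  rewrite -[shear2 c]compf1 -[idm _]pair_prj !shear2_pair.
  by rewrite -addrA -compDl subrr comp0f addr0.
rewrite -[shear2 (- c)]compf1 -[idm _]pair_prj !shear2_pair.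
by rewrite -addrA -compDl addNr comp0f addr0.
Qed.

End Pairing.

(** * Elementary properties of the bifunctor $\mathbb{E}$ *)

Section ExtensionTheory.
Variables (C : additiveCategory) (E : additiveBifunctor C).

Lemma pull_comp (X X' X'' Y : C) (c : mor X' X) (c' : mor X'' X') (d : E X Y) :
  pull (c ⋅ c') d = pull c' (pull c d).
Proof. by rewrite /pull -bfmap_comp comp1f. Qed.

Lemma pull0 (X X' Y : C) (c : mor X' X) : pull c (0 : E X Y) = 0.
Proof. exact: raddf0. Qed.

Lemma push0 (X Y Y' : C) (a : mor Y Y') : push a (0 : E X Y) = 0.
Proof. exact: raddf0. Qed.

Lemma bfmap0l (X X' Y Y' : C) (a : mor Y Y') (d : E X Y) :
  bfmap E (0 : mor X' X) a d = 0.
Proof. by apply: (addrI (bfmap E 0 a d)); rewrite -bfmapDl !addr0. Qed.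

Lemma bfmap0r (X X' Y Y' : C) (c : mor X' X) (d : E X Y) :
  bfmap E c (0 : mor Y Y') d = 0.
Proof. by apply: (addrI (bfmap E c 0 d)); rewrite -bfmapDr !addr0. Qed.

(** Additivity of the realization speaks of any element with components $(d_1,0,0,d_2)$; this
    supplies one. *)
Lemma ext_dsum_ex (X1 X2 Y1 Y2 : C) (d1 : E X1 Y1) (d2 : E X2 Y2) :
  exists d, is_ext_dsum d1 d2 d.
Proof.
exists (bfmap E (prj1 X1 X2) (inj1 Y1 Y2) d1
        + bfmap E (prj2 X1 X2) (inj2 Y1 Y2) d2).
by split; rewrite raddfD /= -!bfmap_comp
  ?prj1_inj1 ?prj2_inj2 ?prj1_inj2 ?prj2_inj1
  ?bfmap1 ?bfmap0l ?bfmap0r ?addr0 ?add0r.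
Qed.

End ExtensionTheory.

(** * Deflations and their closure properties *)

Section Deflations.
Variables (C : additiveCategory) (E : additiveBifunctor C).
Variable s : realizationData E.

Definition deflation (B X : C) (y : mor B X) : Prop :=
  exists (A : C) (d : E X A) (x : mor A B), realizes s d x y.

Lemma deflation_iso (B B' X : C) (b : mor B B') (y : mor B' X) :
  is_iso b -> deflation y -> deflation (y ⋅ b).
Proof.
move=> [b' [b'b bb']] [A [d [x xy]]]; exists A, d, (b' ⋅ x).
apply/(realizes_class _ _ xy); exists b'; split; first by exists b.
  by [].
by rewrite -compA bb' compf1.
Qed.

Hypothesis hE : is_extriangulated s.

Lemma deflation_prj2 (X Y : C) : deflation (prj2 X Y).
Proof. by case: hE => -[_ s0 _] _ _ _ _; exists X, 0, (inj1 X Y). Qed.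

(** The identity is the split projection $0 \oplus X \to X$ up to an isomorphism of the middle
    term. *)
Lemma deflation_id (X : C) : deflation (idm X).
Proof.
have b_iso : is_iso (inj2 (zeroob : C) X).
  exists (prj2 zeroob X); split; first exact: prj2_inj2.
  by rewrite -inj_prj [prj1 _ _]to_zeroob compf0 add0r.
by rewrite -(prj2_inj2 zeroob X); apply/deflation_iso/deflation_prj2.
Qed.

Lemma deflation_dsum (B1 X1 B2 X2 : C) (y1 : mor B1 X1) (y2 : mor B2 X2) :
  deflation y1 -> deflation y2 -> deflation (dsum_map y1 y2).
Proof.
case: hE => -[_ _ sD] _ _ _ _ [A1 [d1 [x1 xy1]]] [A2 [d2 [x2 xy2]]].
have [d hd] := ext_dsum_ex d1 d2.
by exists (A1 ⊕ A2), d, (dsum_map x1 x2); apply: sD hd xy1 xy2.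
Qed.

Lemma deflation_comp (B X Y : C) (y : mor B X) (z : mor X Y) :
  deflation y -> deflation z -> deflation (z ⋅ y).
Proof.
case: hE => _ _ _ _ et4op [A [d [x xy]]] [F [d' [w wz]]].
have [G [_ [_ [h' [d'' [[_ _ r] _]]]]]] := et4op _ _ _ _ _ _ _ _ _ _ _ xy wz.
by exists G, d'', h'.
Qed.

(* The exactness of C(W,B) -> C(W,X) -> E(W,A) at the middle term. *)
Lemma factors_deflation (A B X W : C) (d : E X A) (x : mor A B) (y : mor B X)
    (g : mor W X) :
  realizes s d x y -> pull g d = 0 <-> exists h : mor W B, y ⋅ h = g.
Proof.
case: hE => -[rz s0 _] _ et3op _ _ xy; split=> [gd0|[h <-]].
  (* As $g^*d = 0$, the split conflation $A \to A \oplus W \to W$ maps to the one of $d$ over $g$;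
     the middle map restricted to $W$ is the factorization. *)
  have m0 : ext_morphism (0 : E W A) d (idm A) g.
    by rewrite /ext_morphism push0 gd0.
  have [b [_ yb]] := rz _ _ _ _ _ _ _ _ _ _ _ _ _ _ m0 (s0 A W) xy.
  by exists (b ⋅ inj2 A W); rewrite compA yb -compA prj2_inj2 compf1.
(* The conflation $0 \to 0 \oplus B \to B$ of the zero extension maps to that of $d$ over $y$, which
   gives $y^*d = 0$. *)
have [a [_]] := et3op _ _ _ _ _ _ _ _ _ _ _ _ (prj2 zeroob B) y
  (s0 zeroob B) xy erefl.
by rewrite push0 pull_comp => <-; rewrite pull0.
Qed.

End Deflations.

(** * Finite generation and presentation in terms of elements *)

Section Modules.
Variable C : additiveCategory.
Implicit Types M N : rmodule C.

Lemma mactBl M (X Y : C) (f g : mor X Y) (m : M Y) :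
  mact M (f - g) m = mact M f m - mact M g m.
Proof. by apply: (addIr (mact M g m)); rewrite -mactD !subrK. Qed.

Lemma mhfunD M N (u : modhom M N) X : {morph u X : m n / m + n}.
Proof.
by move=> m n; apply: (addIr (- u X n)); rewrite -mhfunB !addrK.
Qed.

Definition generates M (X : C) (m : M X) : Prop :=
  forall W (n : M W), exists g : mor W X, mact M g m = n.

(* [k] generates the right annihilator of [m]; equivalently the sequence
   C(-,Z) -k-> C(-,X) -m-> M is exact. *)
Definition annihilator M (Z X : C) (k : mor Z X) (m : M X) : Prop :=
  forall W (g : mor W X), mact M g m = 0 <-> exists h : mor W Z, k ⋅ h = g.

Lemma annihilator0 M (Z X : C) (k : mor Z X) (m : M X) :
  annihilator k m -> mact M k m = 0.
Proof. by move=> km; apply/km; exists (idm Z); rewrite compf1. Qed.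

Definition yoneda_elt M (X : C) (m : M X) : modhom (yoneda X) M.
Proof.
exists (fun W (g : mor W X) => mact M g m).
  by move=> W g g'; apply: mactBl.
by move=> W W' f g; apply: mact_comp.
Defined.

Lemma yoneda_eltE M (X W : C) (p : modhom (yoneda X) M) (g : mor W X) :
  p W g = mact M g (p X (idm X)).
Proof. by rewrite -mhnat /= /precomp comp1f. Qed.

(** By Yoneda, [u] is composition with [u Z (idm Z)] and [p] is the action on [p X (idm X)]. *)
Lemma mod_exact_annihilator M (Z X : C) (u : modhom (yoneda Z) (yoneda X))
    (p : modhom (yoneda X) M) :
  mod_exact u p <-> annihilator (u Z (idm Z)) (p X (idm X)).
Proof.
have uE W (h : mor W Z) : u W h = u Z (idm Z) ⋅ h by rewrite yoneda_eltE.
split=> up W g.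
  by rewrite -yoneda_eltE; split=> [/up|] [h <-];
    [exists h; rewrite (uE W h) | apply/up; exists h; rewrite (uE W h)].
by rewrite yoneda_eltE; split=> [/up|] [h <-];
  [exists h; rewrite (uE W h) | apply/up; exists h; rewrite (uE W h)].
Qed.

Lemma mod_surjective_generates M (X : C) (p : modhom (yoneda X) M) :
  mod_surjective p <-> generates (p X (idm X)).
Proof.
by split=> hp W n; have [g <-] := hp W n; exists g; rewrite -yoneda_eltE.
Qed.

Lemma finitely_generatedP M :
  finitely_generated M <-> exists (X : C) (m : M X), generates m.
Proof.
split=> [[X [p /mod_surjective_generates gp]]|[X [m gm]]].
  by exists X, (p X (idm X)).
by exists X, (yoneda_elt m).
Qed.

Lemma finitely_presentedP M :
  finitely_presented M <-> exists (Z X : C) (k : mor Z X) (m : M X),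
    generates m /\ annihilator k m.
Proof.
split=> [[Z [X [u [p [/mod_exact_annihilator up]]]]]|].
  move=> /mod_surjective_generates gp.
  by exists Z, X, (u Z (idm Z)), (p X (idm X)).
move=> [Z [X [k [m [gm km]]]]]; exists Z, X, (yoneda_map k), (yoneda_elt m).
split; last exact: gm.
by apply/mod_exact_annihilator; rewrite /= compf1 mact1.
Qed.

(** The element with components $(m,n)$ under $M(X \oplus Y) = M(X) \oplus M(Y)$. *)
Definition elt_pair M (X Y : C) (m : M X) (n : M Y) : M (X ⊕ Y) :=
  mact M (prj1 X Y) m + mact M (prj2 X Y) n.

Lemma mact_elt_pair M (W X Y : C) (m : M X) (n : M Y) (g : mor W (X ⊕ Y)) :
  mact M g (elt_pair m n) = mact M (prj1 X Y ⋅ g) m + mact M (prj2 X Y ⋅ g) n.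
Proof. by rewrite raddfD /= !mact_comp. Qed.

End Modules.

(** * Image and cokernel of a morphism of modules *)

Section Image.
Variables (C : additiveCategory) (M N : rmodule C) (u : modhom M N).

(** Boolean by classical logic, so that the generic subgroup and quotient constructions apply. *)
Definition image_pred (X : C) : {pred N X} :=
  fun n => `[< exists m, u X m = n >].
Arguments image_pred : clear implicits.

Lemma image_predP X n : reflect (exists m, u X m = n) (n \in image_pred X).
Proof. exact: asboolP. Qed.

Lemma image_zmod_closed X : zmod_closed (image_pred X).
Proof.
split; first by apply/image_predP; exists 0; apply: modhom0.
move=> _ _ /image_predP[m <-] /image_predP[n <-].
by apply/image_predP; exists (m - n); rewrite mhfunB.
Qed.

HB.instance Definition _ X :=
  GRing.isZmodClosed.Build (N X) (image_pred X) (image_zmod_closed X).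

Lemma image_act X Y (f : mor X Y) n :
  n \in image_pred Y -> mact N f n \in image_pred X.
Proof.
move=> /image_predP[m <-]; apply/image_predP.
by exists (mact M f m); rewrite mhnat.
Qed.

Definition image_val (X : C) : Type := {n : N X | n \in image_pred X}.

HB.instance Definition _ X := SubType.on (image_val X).
HB.instance Definition _ X := Choice.on (image_val X).
HB.instance Definition _ X := [SubChoice_isSubZmodule of image_val X by <:].

Section ImageAction.
Variables (X Y : C) (f : mor X Y).

Definition image_mact (n : image_val Y) : image_val X :=
  exist _ (mact N f (val n)) (image_act f (valP n)).

Lemma image_mact_zmod_morphism : zmod_morphism image_mact.
Proof. by move=> m n; apply: val_inj; rewrite /= raddfB. Qed.

HB.instance Definition _ :=
  GRing.isZmodMorphism.Build (image_val Y) (image_val X) image_mact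
    image_mact_zmod_morphism.

End ImageAction.

Definition image_module : rmodule C.
Proof.
refine (@RModule C (fun X => image_val X) (fun X Y f => image_mact f) _ _ _).
- by move=> X n; apply: val_inj; apply: mact1.
- by move=> X Y Z g f n; apply: val_inj; apply: mact_comp.
- by move=> X Y f g n; apply: val_inj; apply: mactD.
Defined.

Definition image_incl : modhom image_module N.
Proof. by exists (fun X (n : image_val X) => val n). Defined.

Lemma image_incl_inj : mod_injective image_incl.
Proof. by move=> X; apply: val_inj. Qed.

Definition coker_val (X : C) : zmodType := {ideal_quot image_pred X}.

Definition coker_pi (X : C) (n : N X) : coker_val X := \pi n.

Lemma coker_piB X : {morph @coker_pi X : m n / m - n}.
Proof. by move=> m n; rewrite /coker_pi raddfB. Qed.

Lemma coker_pi_eq0 X (n : N X) : coker_pi n = 0 <-> exists m, u X m = n.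
Proof.
rewrite -[n in exists m, _ = n]subr0; split=> [n0|/image_predP].
  by apply/image_predP; rewrite Quotient.idealrBE -[\pi n]/(coker_pi n) n0 raddf0.
by rewrite Quotient.idealrBE -[\pi n]/(coker_pi n) raddf0 => /eqP.
Qed.

Lemma coker_pi_surj X (q : coker_val X) : exists n, coker_pi n = q.
Proof. by exists (repr q); rewrite /coker_pi reprK. Qed.

Section CokerAction.
Variables (X Y : C) (f : mor X Y).

Definition coker_mact (q : coker_val Y) : coker_val X :=
  coker_pi (mact N f (repr q)).

(** The representative does not matter: two of them differ by an element of the image, which the
    action preserves. *)
Lemma coker_mact_pi n : coker_mact (coker_pi n) = coker_pi (mact N f n).
Proof.
apply/eqP; rewrite -subr_eq0 -coker_piB -raddfB; apply/eqP/coker_pi_eq0.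
apply/image_predP/image_act/image_predP/coker_pi_eq0.
by rewrite coker_piB {1}/coker_pi reprK subrr.
Qed.

Lemma coker_mact_zmod_morphism : zmod_morphism coker_mact.
Proof.
move=> q r; have [m <-] := coker_pi_surj q; have [n <-] := coker_pi_surj r.
by rewrite -coker_piB !coker_mact_pi raddfB coker_piB.
Qed.

HB.instance Definition _ :=
  GRing.isZmodMorphism.Build (coker_val Y) (coker_val X) coker_mact
    coker_mact_zmod_morphism.

End CokerAction.

Definition coker_module : rmodule C.
Proof.
refine (@RModule C (fun X => coker_val X) (fun X Y f => coker_mact f) _ _ _).
- by move=> X q; have [n <-] := coker_pi_surj q; rewrite /= coker_mact_pi mact1.
- move=> X Y Z g f q; have [n <-] := coker_pi_surj q.
  by rewrite /= !coker_mact_pi mact_comp.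
- move=> X Y f g q; have [n <-] := coker_pi_surj q.
  by rewrite /= !coker_mact_pi mactD /coker_pi raddfD.
Defined.

Definition coker_proj : modhom N coker_module.
Proof.
exists coker_pi; first exact: coker_piB.
by move=> X Y f n; rewrite /= coker_mact_pi.
Defined.

End Image.
Arguments image_pred {C M N} u X.

(** * Cokernels in $\mathsf{Mod}\,\mathcal{C}$ *)

Section Cokernels.
Variable C : additiveCategory.
Implicit Types M N P : rmodule C.

Lemma modhom_eq M N (u v : modhom M N) X (m : M X) : u = v -> u X m = v X m.
Proof. by move=> ->. Qed.

(** The map is defined by chosen preimages under [q]; by exactness two preimages differ by an image
    of [u], which [w] kills. *)
Lemma cokernel_factorization M N P Q (u : modhom M N) (q : modhom N P)
    (w : modhom N Q) :
  mod_exact u q -> mod_surjective q -> (forall X m, w X (u X m) = 0) ->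
  exists v : modhom P Q, forall X n, v X (q X n) = w X n.
Proof.
move=> uq q_surj wu.
pose v X (p : P X) : Q X := w X (projT1 (boolp.cid (q_surj X p))).
have vE X n : v X (q X n) = w X n.
  rewrite /v; case: boolp.cid => n' /= qn'; apply/eqP; rewrite -subr_eq0 -mhfunB.
  have /uq[m <-] : q X (n' - n) = 0 by rewrite mhfunB qn' subrr.
  by rewrite wu.
suff [vB vn] : (forall X, zmod_morphism (v X)) /\
    (forall X Y (f : mor X Y) p, v X (mact P f p) = mact Q f (v Y p)).
  by exists (ModHom vB vn).
split=> [X p p'|X Y f p].
  have [n <-] := q_surj X p; have [n' <-] := q_surj X p'.
  by rewrite -mhfunB !vE mhfunB.
by have [n <-] := q_surj Y p; rewrite -mhnat !vE mhnat.
Qed.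

(** The universal property is tested on two concrete cokernels: that of [u] yields exactness, and
    that of [q], whose projection must vanish by uniqueness, yields surjectivity. *)
Lemma is_cokernelP M N P (u : modhom M N) (q : modhom N P) :
  is_cokernel (u : hom (M : Mod C) N) (q : hom (N : Mod C) P) <->
  mod_exact u q /\ mod_surjective q.
Proof.
split=> [[qu0 q_univ]|[uq q_surj]].
  have q0 X m : q X (u X m) = 0 by apply: (modhom_eq m qu0).
  split=> [X n|X p].
    split=> [qn0|[m <-] //].
    have /q_univ[v [vq _]] :
        (coker_proj u : hom (N : Mod C) _) ∘ (u : hom (M : Mod C) N) = czero _ _.
      by apply: modhomP => W m; apply/coker_pi_eq0; exists m.
    apply/coker_pi_eq0; rewrite -[LHS](modhom_eq n vq) /= qn0.
    exact: (modhom0 (v : modhom P (coker_module u))).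
  have [|v [_ v_uniq]] := q_univ _ (czero (N : Mod C) (coker_module q)).
    exact: modhomP.
  apply/coker_pi_eq0; rewrite -[coker_pi _ _]/(coker_proj q X p).
  rewrite -(v_uniq (coker_proj q)) ?(v_uniq (czero _ _)) //.
    exact: modhomP.
  by apply: modhomP => W n; apply/coker_pi_eq0; exists n.
split; first by apply: modhomP => X m; apply/uq; exists m.
move=> Q w wu0.
have [X m|v vE] := cokernel_factorization (w := w) uq q_surj.
  exact: (modhom_eq m wu0).
exists v; split; first by apply: modhomP => X n; apply: vE.
move=> v' v'E; apply: modhomP => X p; have [n <-] := q_surj X p.
by rewrite vE -(modhom_eq n v'E).
Qed.

End Cokernels.

(** * Coherent modules, and morphisms of $\mathsf{coh}\,\mathcal{C}$ tested on elements *)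

Section Coherence.
Variable C : additiveCategory.
Implicit Types M N : rmodule C.

(** A finitely generated submodule is generated by one element, and the annihilator of this element
    is the same in the submodule as in [M]. *)
Lemma coherentP M :
  coherent M <-> (exists (X : C) (m : M X), generates m) /\
    forall (X : C) (n : M X), exists (Z : C) (k : mor Z X), annihilator k n.
Proof.
split=> [[/finitely_presentedP[Z [X [k [m [gm _]]]]] coh_M]|[[X [m gm]] ann]].
  split=> [|{X k m gm} X n]; first by exists X, m.
  have nP : n \in image_pred (yoneda_elt n) X.
    by apply/image_predP; exists (idm X); apply: mact1.
  have fgn : finitely_generated (image_module (yoneda_elt n)).
    apply/finitely_generatedP; exists X, (exist _ n nP) => W [n' n'P].
    by have /image_predP[g gn] := n'P; exists g; apply: val_inj.
  have [Y [X' [y [[n' n'P] [gn' yn']]]]] :=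
    iffLR (finitely_presentedP _) (coh_M _ _ (@image_incl_inj _ _ _ _) fgn).
  have [b /(congr1 val)/= n'b] := gn' X (exist _ n nP).
  have /image_predP[a /= na] := n'P.
  (* n' = n a and n = n' b, so that n g = 0 iff b g factors through y, and then
     g = (1 - a b) g + a (b g). *)
  exists (Y ⊕ X), ((a ⋅ y) ⋅ prj1 Y X + (idm X - a ⋅ b) ⋅ prj2 Y X) => W g.
  split=> [gn|[h <-]].
    have /yn'[h yh] :
        mact (image_module (yoneda_elt n)) (b ⋅ g) (exist _ n' n'P) = 0.
      by apply: val_inj; rewrite /= mact_comp n'b.
    exists (pair_mor h g); rewrite compDl -!compA prj1_pair prj2_pair yh.
    by rewrite compBl comp1f !compA addrC subrK.
  have /(congr1 val)/= n'y0 := annihilator0 yn'.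
  rewrite mact_comp mactD !mact_comp na n'y0 mactBl mact1 mact_comp na n'b.
  by rewrite subrr !raddf0 addr0 raddf0.
split=> [|N i i_inj /finitely_generatedP[Y [n gn]]].
  by have [Z [k km]] := ann X m; apply/finitely_presentedP; exists Z, X, k, m.
have [Z [k kn]] := ann Y (i Y n).
apply/finitely_presentedP; exists Z, Y, k, n; split=> // W g.
rewrite -kn -mhnat; split=> [->|gn0]; first exact: modhom0.
by apply: i_inj; rewrite gn0 modhom0.
Qed.

Lemma coherent_cyclic M (X : C) (m : M X) :
  coherent M -> coherent (image_module (yoneda_elt m)).
Proof.
move=> /coherentP[_ ann]; apply/coherentP; split=> [|Y n].
  have mP : m \in image_pred (yoneda_elt m) X.
    by apply/image_predP; exists (idm X); apply: mact1.
  exists X, (exist _ m mP) => W [n nP].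
  by have /image_predP[g gm] := nP; exists g; apply: val_inj.
have [Z [k kn]] := ann Y (val n); exists Z, k => W g.
by rewrite -kn; split=> [/(congr1 val)|gn0] //; apply: val_inj.
Qed.

(** The class of $w$ is killed by $g$ iff $wg = u(v)$ for some $v$. Writing $v = -mf$ with the
    generator $m$, this says that $(g,f)$ annihilates the pair $(w,u(m))$; so the annihilator of the
    class is the first component of that of the pair. *)
Lemma coherent_coker M N (u : modhom M N) :
  coherent M -> coherent N -> coherent (coker_module u).
Proof.
move=> /coherentP[[X [m gm]] _] /coherentP[[Y [n gn]] ann].
apply/coherentP; split=> [|W q].
  exists Y, (coker_proj u Y n) => W q; have [n' <-] := coker_pi_surj q.
  by have [g <-] := gn W n'; exists g; rewrite -mhnat.
have [w <-] := coker_pi_surj q.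
have [Z [k kP]] := ann _ (elt_pair w (u X m)).
exists Z, (prj1 W X ⋅ k) => V g.
rewrite -[mact _ _ _]/(mact (coker_module u) g (coker_proj u W w)) -mhnat.
rewrite /= coker_pi_eq0; split=> [[v uv]|[h <-]].
  have [f fm] := gm V (- v).
  have /kP[h kh] : mact N (pair_mor g f) (elt_pair w (u X m)) = 0.
    by rewrite mact_elt_pair prj1_pair prj2_pair -[X in _ + X]mhnat fm
      -uv -mhfunD subrr modhom0.
  by exists h; rewrite -compA kh prj1_pair.
exists (- mact M (prj2 W X ⋅ k ⋅ h) m); rewrite -sub0r mhfunB modhom0 mhnat.
have /eqP : mact N (k ⋅ h) (elt_pair w (u X m)) = 0 by apply/kP; exists h.
by rewrite mact_elt_pair !compA addr_eq0 sub0r => /eqP ->.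
Qed.

Lemma coh_hom_eq (M N : coh C) (u v : hom M N) X (m : sval M X) :
  u = v -> mhfun u m = mhfun v m.
Proof. by move=> ->. Qed.

Section CohMorphisms.
Variables M N P : coh C.

(** If $f(m) = 0$, then $f$ kills the coherent submodule generated by $m$, so the inclusion of this
    submodule is zero. *)
Lemma coh_is_monoP (f : hom M N) :
  is_mono f -> mod_injective (f : modhom (sval M) (sval N)).
Proof.
move=> f_mono X; suff f0 m : mhfun f m = 0 -> m = 0 :> sval M X.
  by move=> m n mn; apply/eqP; rewrite -subr_eq0; apply/eqP/f0;
    rewrite mhfunB mn subrr.
move=> fm0; pose I := exist _ _ (coherent_cyclic m (svalP M)) : coh C.
have mP : m \in image_pred (yoneda_elt m) X.
  by apply/image_predP; exists (idm X); apply: mact1.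
have /f_mono i0 : f ∘ (image_incl (yoneda_elt m) : hom I M) = f ∘ czero I M.
  apply: modhomP => W [n nP]; have /image_predP[g gm] := nP.
  by rewrite /= -gm /= mhnat fm0 raddf0 modhom0.
exact: (@coh_hom_eq I M _ _ X (exist _ m mP) i0).
Qed.

(** The projection onto the coherent cokernel of $f$ agrees with zero after $f$, hence is zero. *)
Lemma coh_is_epiP (f : hom M N) :
  is_epi f -> mod_surjective (f : modhom (sval M) (sval N)).
Proof.
move=> f_epi X n.
pose Q := exist _ _ (coherent_coker f (svalP M) (svalP N)) : coh C.
have /f_epi q0 : (coker_proj f : hom N Q) ∘ f = czero N Q ∘ f.
  by apply: modhomP => W m; apply/coker_pi_eq0; exists m.
by apply/coker_pi_eq0; apply: (coh_hom_eq n q0).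
Qed.

(** For $g(n) = 0$, the inclusion of the submodule generated by $n$ factors through $f$; evaluating
    at $n$ gives a preimage. *)
Lemma coh_is_kernel_exact (f : hom M N) (g : hom N P) :
  is_kernel f g ->
  mod_exact (f : modhom (sval M) (sval N)) (g : modhom (sval N) (sval P)).
Proof.
move=> [gf0 f_univ] X n; split=> [gn0|[m <-]]; last exact: (coh_hom_eq m gf0).
pose I := exist _ _ (coherent_cyclic n (svalP N)) : coh C.
have nP : n \in image_pred (yoneda_elt n) X.
  by apply/image_predP; exists (idm X); apply: mact1.
have [|v [fv _]] := f_univ I (image_incl (yoneda_elt n)).
  apply: modhomP => W [n' n'P]; have /image_predP[h hn] := n'P.
  by rewrite /= -hn /= mhnat gn0 raddf0.
exists (mhfun v (exist _ n nP : image_module _ X)).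
exact: (@coh_hom_eq I N _ _ X (exist _ n nP) fv).
Qed.

End CohMorphisms.

Lemma is_kernel_mono (A : category) (X Y Z : A) (f : hom X Y) (g : hom Y Z) :
  is_kernel f g -> is_mono f.
Proof.
move=> [gf0 f_univ] W u v fuv.
have [|w [_ w_uniq]] := f_univ W (f ∘ u); first by rewrite ccompA gf0 ccomp0f.
by rewrite -(w_uniq u) // (w_uniq v).
Qed.

Lemma is_cokernel_epi (A : category) (X Y Z : A) (f : hom X Y) (g : hom Y Z) :
  is_cokernel f g -> is_epi g.
Proof.
move=> [gf0 g_univ] W u v ugv.
have [|w [_ w_uniq]] := g_univ W (u ∘ g); first by rewrite -ccompA gf0 ccompf0.
by rewrite -(w_uniq u) // (w_uniq v).
Qed.

End Coherence.

(** * Binary products of modules *)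

Section Product.
Variables (C : additiveCategory) (M N : rmodule C).

Section ProductAction.
Variables (X Y : C) (f : mor X Y).

Definition prod_mact (p : (M Y * N Y)%type) : (M X * N X)%type :=
  (mact M f p.1, mact N f p.2).

Lemma prod_mact_zmod_morphism : zmod_morphism prod_mact.
Proof. by move=> p q; rewrite /prod_mact !raddfB. Qed.

HB.instance Definition _ :=
  GRing.isZmodMorphism.Build (M Y * N Y)%type (M X * N X)%type prod_mact
    prod_mact_zmod_morphism.

End ProductAction.

Definition prod_module : rmodule C.
Proof.
refine (@RModule C (fun X => (M X * N X)%type) (fun X Y f => prod_mact f) _ _ _).
- by move=> X [m n]; rewrite /= /prod_mact !mact1.
- by move=> X Y Z g f [m n]; rewrite /= /prod_mact !mact_comp.
- by move=> X Y f g [m n]; rewrite /= /prod_mact !mactD.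
Defined.

Definition prod_inl : modhom M prod_module.
Proof.
exists (fun X (m : M X) => (m, 0) : (M X * N X)%type) => [X m m'|X Y f m].
  by rewrite -[RHS]/(m - m', 0 - 0) subr0.
by rewrite /= /prod_mact raddf0.
Defined.

Definition prod_inr : modhom N prod_module.
Proof.
exists (fun X (n : N X) => (0, n) : (M X * N X)%type) => [X n n'|X Y f n].
  by rewrite -[RHS]/(0 - 0, n - n') subr0.
by rewrite /= /prod_mact raddf0.
Defined.

Definition prod_fst : modhom prod_module M.
Proof. by exists (fun X (p : (M X * N X)%type) => p.1). Defined.

Definition prod_snd : modhom prod_module N.
Proof. by exists (fun X (p : (M X * N X)%type) => p.2). Defined.

Definition prod_pair L (u : modhom L M) (v : modhom L N) : modhom L prod_module.
Proof.
exists (fun X l => (u X l, v X l) : (M X * N X)%type) => [X l l'|X Y f l].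
  by rewrite -[RHS]/(u X l - u X l', v X l - v X l') !mhfunB.
by rewrite !mhnat.
Defined.

Definition prod_copair L (u : modhom M L) (v : modhom N L) : modhom prod_module L.
Proof.
exists (fun X (p : (M X * N X)%type) => u X p.1 + v X p.2) => [X p p'|X Y f p].
  by rewrite /= !mhfunB addrACA -opprD.
by rewrite /= !mhnat raddfD.
Defined.

Lemma prod_inl_inr X (p : prod_module X) :
  prod_inl X p.1 + prod_inr X p.2 = p.
Proof.
by case: p => m n; rewrite -[LHS]/(m + 0, 0 + n) addr0 add0r.
Qed.

End Product.

(** * Closure properties of the category of defects *)

Section DefectTheory.
Variables (C : additiveCategory) (E : additiveBifunctor C).
Variable s : realizationData E.
Hypothesis hE : is_extriangulated s.
Implicit Types M N : rmodule C.

(** The generator is the image of the identity of [X], carried along the isomorphism with the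
    defect. *)
Lemma in_defP M :
  in_def s M <-> exists (B X : C) (y : mor B X) (m : M X),
    [/\ deflation s y, generates m & annihilator y m].
Proof.
split=> [[A [X [d [D [[B [x [y [q [xy]]]]]]]]]]|[B [X [y [m [dy gm ym]]]]]].
  move=> /is_cokernelP[/mod_exact_annihilator yq /mod_surjective_generates gq].
  move=> [f [g [gf fg]]]; rewrite /= compf1 in yq.
  have fgE W n : mhfun f (mhfun g n) = n :> D W by apply: (modhom_eq n fg).
  have gfE W n : mhfun g (mhfun f n) = n :> M W by apply: (modhom_eq n gf).
  exists B, X, y, (mhfun g (mhfun q (idm X))); split=> [|W n|W h].
  - by exists A, d, x.
  - have [h hn] := gq W (mhfun f n); exists h.
    by rewrite -mhnat hn gfE.
  - rewrite -yq -mhnat; split=> [g0|->]; last exact: modhom0.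
    by rewrite -[LHS]fgE g0 modhom0.
have [A [d [x xy]]] := dy.
exists A, X, d, M; split; last first.
  by exists (cid (M : Mod C)), (cid (M : Mod C)); rewrite ccomp1f.
exists B, x, y, (yoneda_elt m); split=> //.
apply/is_cokernelP; split; last exact: gm.
by apply/mod_exact_annihilator; rewrite /= compf1 mact1.
Qed.

(* [m] generates a copy of the image of C(-,X) -> E(-,A), h |-> h^*d, in which
   the submodule generated by [mact M g m] is the defect of g^*d. *)
Lemma annihilator_pull M (A B X Y : C) (d : E X A) (x : mor A B) (y : mor B X)
    (m : M X) (g : mor Y X) :
  realizes s d x y -> annihilator y m ->
  exists (B' : C) (y' : mor B' Y), deflation s y' /\ annihilator y' (mact M g m).
Proof.
move=> xy ym; have [B' [x' [y' xy']]] := realizes_ex s (pull g d).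
exists B', y'; split=> [|W h]; first by exists A, (pull g d), x'.
by rewrite -(factors_deflation hE h xy') -pull_comp
  (factors_deflation hE (g ⋅ h) xy) -mact_comp ym.
Qed.

Lemma in_def_coherent M : in_def s M -> coherent M.
Proof.
move=> /in_defP[B [X [y [m [[A [d [x xy]]] gm ym]]]]].
apply/coherentP; split=> [|Y n]; first by exists X, m.
have [g <-] := gm Y n.
by have [B' [y' [_ y'm]]] := annihilator_pull g xy ym; exists B', y'.
Qed.

(** The generator of [M] goes to some multiple $mg$ of the generator of [N], and injectivity makes
    the two annihilators equal. *)
Lemma in_def_sub M N (u : modhom M N) :
  mod_injective u -> finitely_generated M -> in_def s N -> in_def s M.
Proof.
move=> u_inj /finitely_generatedP[Y [n gn]].
move=> /in_defP[B [X [y [m [[A [d [x xy]]] gm ym]]]]].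
have [g gmn] := gm Y (u Y n).
have [B' [y' [dy' y'm]]] := annihilator_pull g xy ym.
apply/in_defP; exists B', Y, y', n; split=> // W h.
rewrite -y'm gmn -mhnat; split=> [->|un0]; first exact: modhom0.
by apply: u_inj; rewrite un0 modhom0.
Qed.

(** Coherence gives a generator $k$ of the annihilator of $u(m)$. Since $y$ kills $u(m)$ too,
    $[k,y]$ generates the same annihilator, and adjoining $y$ makes it a deflation. *)
Lemma in_def_quotient M N (u : modhom M N) :
  mod_surjective u -> coherent N -> in_def s M -> in_def s N.
Proof.
move=> u_surj /coherentP[_ ann] /in_defP[B [X [y [m [dy gm ym]]]]].
have [Z [k km]] := ann X (u X m).
apply/in_defP; exists (Z ⊕ B), X.
exists (prj2 Z X ⋅ (shear2 k ⋅ dsum_map (idm Z) y)), (u X m).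
have kE W (g : mor W Z) (h : mor W B) :
    prj2 Z X ⋅ (shear2 k ⋅ dsum_map (idm Z) y) ⋅ pair_mor g h = y ⋅ h + k ⋅ g.
  by rewrite -!compA dsum_map_pair shear2_pair prj2_pair comp1f.
split=> [|W n|W g].
- rewrite compA; apply: (deflation_comp hE).
    by apply: (deflation_dsum hE) => //; apply: deflation_id.
  by apply: deflation_iso; [apply: shear2_iso|apply: deflation_prj2].
- have [n' <-] := u_surj W n; have [g <-] := gm W n'.
  by exists g; rewrite mhnat.
split=> [|[h <-]].
  move=> /km[h hg]; exists (pair_mor h 0).
  by rewrite kE compf0 add0r.
rewrite -[h]pair_prj kE mactD !mact_comp (annihilator0 km) !raddf0 addr0.
by rewrite -mhnat (annihilator0 ym) modhom0 !raddf0.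
Qed.

(** A horseshoe argument: the generator $m_2$ is lifted to $n_2$, and the failure of $y_2$ to kill
    $n_2$ is the correction term $c$ of the presentation. *)
Lemma in_def_extension M1 M M2 (f : modhom M1 M) (g : modhom M M2) :
  mod_injective f -> mod_exact f g -> mod_surjective g ->
  in_def s M1 -> in_def s M2 -> in_def s M.
Proof.
move=> f_inj fg g_surj /in_defP[B1 [X1 [y1 [m1 [dy1 gm1 ym1]]]]].
move=> /in_defP[B2 [X2 [y2 [m2 [dy2 gm2 ym2]]]]].
have [n2 gn2] := g_surj X2 m2.
have /fg[l fl] : g B2 (mact M y2 n2) = 0.
  by rewrite mhnat gn2 (annihilator0 ym2).
have [c cl] := gm1 B2 l.
(* The kernel of the cover of M by X1 + X2 is given by the matrix
   [[y1, -c], [0, y2]]. *)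
have kE W (h1 : mor W B1) (h2 : mor W B2) :
    dsum_map (idm X1) y2 ⋅ shear1 (- c) ⋅ dsum_map y1 (idm B2) ⋅ pair_mor h1 h2
    = pair_mor (y1 ⋅ h1 - c ⋅ h2) (y2 ⋅ h2).
  rewrite -!compA !(dsum_map_pair, shear1_pair) !comp1f.
  by rewrite -[- c]sub0r compBl comp0f sub0r.
apply/in_defP; exists (B1 ⊕ B2), (X1 ⊕ X2).
(* The matrix factors as $[[1,0],[0,y_2]] \cdot [[1,-c],[0,1]] \cdot [[y_1,0],[0,1]]$. *)
exists (dsum_map (idm X1) y2 ⋅ shear1 (- c) ⋅ dsum_map y1 (idm B2)).
exists (elt_pair (f X1 m1) n2); split=> [|W n|W h].
- apply: (deflation_comp hE).
    by apply: (deflation_dsum hE) => //; apply: deflation_id.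
  apply: deflation_iso; first exact: shear1_iso.
  by apply: (deflation_dsum hE) => //; apply: deflation_id.
- have [h2 h2n] := gm2 W (g W n).
  have /fg[n1 fn1] : g W (n - mact M h2 n2) = 0.
    by rewrite mhfunB mhnat gn2 h2n subrr.
  have [h1 h1n] := gm1 W n1; exists (pair_mor h1 h2).
  by rewrite mact_elt_pair prj1_pair prj2_pair -mhnat h1n fn1 subrK.
rewrite mact_elt_pair -mhnat.
split=> [h0|[k <-]].
  (* Applying [g] removes the summand from [M1], so the second component of [h] factors through
     [y2]. *)
  have /ym2[k2 k2E] : mact M2 (prj2 X1 X2 ⋅ h) m2 = 0.
    rewrite -gn2 -mhnat -[RHS](modhom0 g) -h0 mhfunD.
    suff /fg-> : exists m', f W m' = f W (mact M1 (prj1 X1 X2 ⋅ h) m1).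
      by rewrite add0r.
    by eexists.
  (* As $n_2 y_2 = f(m_1 c)$, the relation now lies in the image of [f], and its coefficient at [m1]
     factors through [y1]. *)
  have /ym1[k1 k1E] : mact M1 (prj1 X1 X2 ⋅ h + c ⋅ k2) m1 = 0.
    apply: f_inj; rewrite mactD mhfunD modhom0 -[RHS]h0 -k2E; congr (_ + _).
    by rewrite !mact_comp cl mhnat fl.
  by exists (pair_mor k1 k2); rewrite kE k1E k2E addrK pair_prj.
rewrite -[k]pair_prj kE prj1_pair prj2_pair mactBl !mact_comp.
rewrite (annihilator0 ym1) !raddf0 sub0r cl -fl -!mact_comp -!mhnat -mhfunD.
by rewrite addNr modhom0.
Qed.

(** The product is a split extension. *)
Lemma in_def_prod M N : in_def s M -> in_def s N -> in_def s (prod_module M N).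
Proof.
apply: (@in_def_extension _ _ _ (prod_inl M N) (prod_snd M N)) => [X|X [m n]|X n].
- by move=> m m' [].
- by split=> [/= ->|[m' [_ <-]] //]; exists m.
- by exists (0, n).
Qed.

Lemma in_def_yoneda0 : in_def s (yoneda (zeroob : C)).
Proof.
apply/in_defP; exists zeroob, zeroob, (idm zeroob), (idm zeroob); split=> [|W n|W g].
- exact: deflation_id.
- by exists n; apply: comp1f.
- by split=> _; [exists g; apply: comp1f|apply: to_zeroob].
Qed.

End DefectTheory.

(** * The Serre property *)

Lemma yoneda0_eq0 (C : additiveCategory) (W : C) (n : yoneda (zeroob : C) W) : n = 0.
Proof. exact: to_zeroob. Qed.

Theorem proposition1 (C : additiveCategory) (E : additiveBifunctor C)
    (s : realizationData E)
    (hC : skeletally_small C) (hE : is_extriangulated s) :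
  (forall M : Mod C, in_def s M -> coherent M) /\
  serre_subcategory (A := coh C) (fun M : coh C => in_def s (proj1_sig M)).
Proof.
have coh_fg (M : coh C) : finitely_generated (sval M).
  by have /coherentP[/finitely_generatedP] := svalP M.
split=> [M|]; first exact: in_def_coherent.
split=> [|M N f /coh_is_monoP f_inj|M N f /coh_is_epiP f_surj|].
- split.
  + move=> M N [f [g [_ fg]]].
    (* The inverse [g] embeds [N] into [M]. *)
    apply: (@in_def_sub _ _ _ hE _ _ (g : modhom _ _)) => // X.
    by apply: (can_inj (g := mhfun f)) => n; apply: (coh_hom_eq n fg).
  + have d0 := in_def_yoneda0 hE.
    exists (exist _ _ (in_def_coherent hE d0)); split=> //.
    split=> M f; apply: modhomP => X m /=; first exact: yoneda0_eq0.
    by rewrite (yoneda0_eq0 m) modhom0.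
  + move=> M N dM dN; have dP := in_def_prod hE dM dN.
    (* The product is coherent because it is itself a defect, so the biproduct can be formed in
       $\mathsf{coh}\,\mathcal{C}$. *)
    pose P := exist _ _ (in_def_coherent hE dP) : coh C.
    exists P, (prod_inl (sval M) (sval N)), (prod_inr (sval M) (sval N)).
    exists (prod_fst (sval M) (sval N)), (prod_snd (sval M) (sval N)).
    split=> //; split; first by split; apply: modhomP.
    split=> W u v.
      exists (prod_pair u v); split; first by split; apply: modhomP.
      move=> w [<- <-]; apply: modhomP => X l /=.
      by case: (mhfun w l).
    exists (prod_copair u v); split.
      by split; apply: modhomP => X m; rewrite /= modhom0 ?addr0 ?add0r.
    move=> w [<- <-]; apply: modhomP => X p.
    by rewrite -[p in RHS]prod_inl_inr mhfunD.
- exact: (in_def_sub hE f_inj (coh_fg M)).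
- exact: (in_def_quotient hE f_surj (svalP N)).
move=> M1 M M2 f g [fg_ker fg_coker] dM1 dM2.
apply: (in_def_extension hE) dM1 dM2.
- exact/coh_is_monoP/(is_kernel_mono fg_ker).
- exact: coh_is_kernel_exact fg_ker.
- exact/coh_is_epiP/(is_cokernel_epi fg_coker).
Qed.
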